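(* Let $(X,d)$ be a complete metric space and let $T:X\to X$ be a self-mapping such that (i) $d(Tx,Ty)<\frac{1}{2}\{d(x,Tx)+d(y,Ty)\}$ for all $x,y\in X$ with $x\neq y$; (ii) for any $x\in X$ and any $\epsilon>0$ there exists $\delta>0$ such that, for any $i,j\in\mathbb{N}\cup\{0\}$, $d(T^ix,T^jx)<\epsilon+\delta$ implies $d(T^{i+1}x,T^{j+1}x)\leq\epsilon$. Then $T$ has a unique fixed point $z$, and for every $x\in X$ the sequence of iterates $(T^nx)$ converges to $z$.
   Context: Here $T^n$ denotes the $n$-fold iterate of $T$, with $T^0$ the identity map. No continuity of $T$ is assumed. *)

(* Defs.v *)
From HB Require Import structures.
From mathcomp Require Import all_boot all_order all_algebra.
From mathcomp Require Import all_classical all_reals all_analysis.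

Set Implicit Arguments.
Unset Strict Implicit.
Unset Printing Implicit Defensive.

(* The topology and uniformity are those of [mdist] (the balls are the
   [mdist]-balls).  [Complete] includes [isPointed], so the space is nonempty. *)
#[short(type="completeMetricType")]
HB.structure Definition CompleteMetric (K : numDomainType) :=
  {T of Metric K T & Complete T}.

(* Main.v *)
Require Import Defs.
From mathcomp Require Import all_boot all_order all_algebra.
From mathcomp Require Import all_classical all_reals all_analysis.
From mathcomp Require Import lra.

(** Put [d n := d(T^n x, T^(n+1) x)].  By (i) this sequence strictly decreases
    as long as it is nonzero, and (ii) applied to its infimum, if that were
    positive, would show that the infimum is attained; hence [d n] tends to 0.
    Now (i) bounds [d(T^(n+1) x, T^(m+1) x)] by [(d n + d m) / 2], so the
    iterates form a Cauchy sequence, and another use of (i) shows that their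
    limit is fixed, without any continuity of [T]. *)

Import Order.TTheory GRing.Theory Num.Theory.
Import numFieldNormedType.Exports.
Local Open Scope classical_set_scope.
Local Open Scope ring_scope.

Definition strict_kannan {R : realType} {X : metricType R} (T : X -> X) :=
  forall x y : X, x <> y ->
    mdist (T x) (T y) < 2^-1 * (mdist x (T x) + mdist y (T y)).

Section strict_kannan.
Context {R : realType} {X : metricType R} {T : X -> X}.
Hypothesis TK : strict_kannan T.

Lemma strict_kannan_le (x y : X) :
  mdist (T x) (T y) <= 2^-1 * (mdist x (T x) + mdist y (T y)).
Proof.
have [->|/eqP xy] := eqVneq x y; last exact/ltW/TK.
by rewrite mdistxx mulr_ge0// addr_ge0// mdist_ge0.
Qed.

(** With [y = T x] in (i), the left side recurs on the right with factor 1/2 and is absorbed. *)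
Lemma strict_kannan_step_lt (x : X) :
  0 < mdist x (T x) -> mdist (T x) (T (T x)) < mdist x (T x).
Proof. by rewrite mdist_gt0 => /eqP /TK; lra. Qed.

Lemma strict_kannan_step_nonincreasing (x : X) :
  nonincreasing_seq (fun n => mdist (iter n T x) (iter n.+1 T x)).
Proof.
apply/nonincreasing_seqP => n /=.
by have := strict_kannan_le (iter n T x) (T (iter n T x)); lra.
Qed.

Lemma strict_kannan_fixed_unique (z w : X) : T z = z -> T w = w -> w = z.
Proof.
move=> Tz Tw; apply: contrapT => /TK.
by rewrite Tz Tw !mdistxx addr0 mulr0 ltNge mdist_ge0.
Qed.

Lemma strict_kannan_inf_step (x : X) :
  (forall eps : R, 0 < eps -> exists2 delta : R, 0 < delta &
     forall i : nat,
       mdist (iter i T x) (iter i.+1 T x) < eps + delta ->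
       mdist (iter i.+1 T x) (iter i.+2 T x) <= eps) ->
  inf (range (fun n => mdist (iter n T x) (iter n.+1 T x))) = 0.
Proof.
move=> xMK; set D := range _.
have D0 : lbound D 0 by move=> _ [n _ <-]; exact: mdist_ge0.
have infD : has_inf D by split; [exists (mdist x (T x)), 0%N | exists 0].
have inf_le n : inf D <= mdist (iter n T x) (iter n.+1 T x).
  by apply: ge_inf; [exists 0 | exists n].
apply/eqP; rewrite eq_le lb_le_inf ?andbT//; last by case: infD.
rewrite leNgt; apply/negP => r0.
have [delta delta0 Ddelta] := xMK _ r0.
have [_ [n _ <-] /Ddelta dn] := inf_adherent delta0 infD.
(* By [dn] the step at [n.+1] is at most the infimum; it is positive, so the step at [n.+2] falls
   strictly below the infimum. *)
have /= dn1 := strict_kannan_step_lt (iter n.+1 T x) (lt_le_trans r0 (inf_le _)).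
by have /= := inf_le n.+2; rewrite leNgt (lt_le_trans dn1).
Qed.

Lemma strict_kannan_lim_fixed (x z : X) :
  mdist (iter n T x) (iter n.+1 T x) @[n --> \oo] --> (0 : R) ->
  iter n T x @[n --> \oo] --> z -> T z = z.
Proof.
move=> d0 xz; apply/esym/mdist_positivity/eqP.
rewrite eq_le mdist_ge0 andbT; apply/ler_addgt0Pl => e e0; rewrite addr0.
(* Write [a], [b] for the distances from [iter n T x] to [z] and to [iter n.+1 T x]. The triangle
   inequality and (i) give [mdist z (T z) <= a + b + (b + mdist z (T z)) / 2], hence at most
   [2a + 3b]: five terms below [e / 5]. *)
have e5 : 0 < e / 5 by rewrite divr_gt0.
near \oo => n.
have zn : mdist z (iter n T x) < e / 5.
  by near: n; exact: metricType_numDomainType.cvgr_dist_lt xz _ e5.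
have dn : mdist (iter n T x) (iter n.+1 T x) < e / 5.
  by near: n; exact: (cvgr_lt _ d0).
have := metric_triangle z (iter n T x) (T z).
have := metric_triangle (iter n T x) (iter n.+1 T x) (T z).
have := strict_kannan_le (iter n T x) z.
move: zn dn => /=; lra.
Unshelve. all: by end_near. Qed.

End strict_kannan.

Lemma strict_kannan_cvg {R : realType} {X : completeMetricType R} {T : X -> X}
    (x : X) : strict_kannan T ->
  mdist (iter n T x) (iter n.+1 T x) @[n --> \oo] --> (0 : R) ->
  cvg (iter n T x @[n --> \oo]).
Proof.
move=> TK d0; apply: cauchy_cvg; apply: cauchy_exP => e e0.
near \oo => m; exists (iter m.+1 T x).
have dm : mdist (iter m T x) (iter m.+1 T x) < e.
  by near: m; exact: (cvgr_lt _ d0).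
(* Past [m.+1] every iterate is an image under [T], like the centre, so (i) bounds their distance by
   the mean of steps [m] and [n], at most step [m]. *)
exists m.+1 => // -[//|n] /= mn.
rewrite ballEmdist /=; apply: le_lt_trans (strict_kannan_le TK _ _) _.
have /= := strict_kannan_step_nonincreasing TK x m n mn.
move: dm => /=; lra.
Unshelve. all: by end_near. Qed.

Theorem theorem2p8 (R : realType) (X : completeMetricType R) (T : X -> X)
  (hi : forall x y : X, x <> y ->
    mdist (T x) (T y) < 2^-1 * (mdist x (T x) + mdist y (T y)))
  (hii : forall (x : X) (eps : R), 0 < eps ->
    exists2 delta : R, 0 < delta &
      forall i j : nat,
        mdist (iter i T x) (iter j T x) < eps + delta ->
        mdist (iter i.+1 T x) (iter j.+1 T x) <= eps) :
  exists z : X,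
    [/\ T z = z,
        forall w : X, T w = w -> w = z
      & forall x : X, iter n T x @[n --> \oo] --> z].
Proof.
have d0 x : mdist (iter n T x) (iter n.+1 T x) @[n --> \oo] --> (0 : R).
  (* With 0 rewritten as the infimum, monotone convergence applies. *)
  rewrite -(strict_kannan_inf_step hi x).
    apply: nonincreasing_cvgn; first exact: strict_kannan_step_nonincreasing.
    by exists 0 => _ [n _ <-]; exact: mdist_ge0.
  by move=> eps /(hii x)[delta delta0 xMK]; exists delta => // i; exact: xMK.
have lim_fixed x : exists2 z : X, T z = z & iter n T x @[n --> \oo] --> z.
  have /cvg_ex[z xz] := strict_kannan_cvg x hi (d0 x).
  by exists z => //; exact: strict_kannan_lim_fixed (d0 x) xz.
(* One orbit supplies [z]; the limit of any other orbit is also fixed, so uniqueness identifies it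
   with [z]. *)
have [z Tz _] := lim_fixed point.
exists z; split=> // [w Tw|x]; first exact: strict_kannan_fixed_unique hi _ _ Tz Tw.
have [w Tw xw] := lim_fixed x.
by rewrite -(strict_kannan_fixed_unique hi _ _ Tz Tw).
Qed.
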